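(* Let $\mathcal H=(M,n,\mathcal R)$ be a bounded-rate multi-mode system (BMS) and let $S\subseteq\mathbb R^n$ be a bounded convex polytope (the safety set). Then the schedulability game on $\mathcal H$ with safety set $S$ is positionally determined: for every starting state $x_0\in S$, exactly one of the two players (scheduler or environment) has a winning strategy, and that player has a positional winning strategy.
   Context: A multi-mode system is a tuple $\mathcal H=(M,n,\mathcal R)$ where $M$ is a finite nonempty set of modes, $n\ge 1$ is the number of real-valued variables, and $\mathcal R:M\to 2^{\mathbb R^n}$ assigns to each mode a nonempty set of rate vectors. It is a bounded-rate multi-mode system (BMS) if every $\mathcal R(m)$ is a (bounded) convex polytope. The schedulability game from a starting state $x_0\in\mathbb R^n$ proceeds in infinitely many rounds: in round $i\ge 1$ the scheduler chooses a timed move $(m_i,t_i)\in M\times\mathbb R_{>0}$, then the environment chooses a rate $r_i\in\mathcal R(m_i)$, and the state becomes $x_i=x_{i-1}+t_i r_i$. A scheduler strategy maps each finite history $\langle x_0,(m_1,t_1),r_1,x_1,\dots,(m_k,t_k),r_k,x_k\rangle$ to a timed move; an environment strategy maps a finite history together with the scheduler's current timed move $(m,t)$ to a rate in $\mathcal R(m)$. A strategy is positional if its choice depends only on the last state of the history (and, for the environment, on the current timed move). For a safety set $S$, an infinite run is $S$-safe if $x_i\in S$ and $x_i+t r_{i+1}\in S$ for all $i\ge 0$ and all $t\in[0,t_{i+1}]$; it is non-Zeno if $\sum_{i\ge1}t_i=\infty$. A scheduler strategy is winning from $x_0$ if against every environment strategy the resulting run is $S$-safe and non-Zeno; an environment strategy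 is winning from $x_0$ if against every scheduler strategy the resulting run is not both $S$-safe and non-Zeno. *)

(* Defs.v *)
From Stdlib Require Import Reals List.
From Stdlib Require Fin.
Import ListNotations.
Open Scope R_scope.

Definition vec (n : nat) := Fin.t n -> R.
Definition vzero {n} : vec n := fun _ => 0.
Definition vadd {n} (x y : vec n) : vec n := fun i => x i + y i.
Definition vscale {n} (a : R) (x : vec n) : vec n := fun i => a * x i.

Definition in_hull {n} (l : list (vec n)) (x : vec n) : Prop :=
  exists c : list (R * vec n),
    Forall (fun p => 0 <= fst p /\ In (snd p) l) c /\
    fold_right Rplus 0 (map fst c) = 1 /\
    x = fold_right (fun p acc => vadd (vscale (fst p) (snd p)) acc) vzero c.

Definition is_polytope {n} (P : vec n -> Prop) : Prop :=
  exists l : list (vec n), forall x, P x <-> in_hull l x.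

Definition is_BMS (M : Type) (n : nat) (Rt : M -> vec n -> Prop) : Prop :=
  (exists lm : list M, forall m, In m lm) /\ inhabited M /\ (1 <= n)%nat /\
  forall m, is_polytope (Rt m) /\ exists r, Rt m r.

(* A finite history <x0,(m1,t1),r1,x1,...,(mk,tk),rk,xk>: the start state
   and the rounds (m_i,t_i,r_i), most recent first (x_i are determined). *)
Definition hist (M : Type) (n : nat) : Type := (vec n * list (M * R * vec n))%type.

Fixpoint lstate {M n} (x0 : vec n) (l : list (M * R * vec n)) : vec n :=
  match l with
  | [] => x0
  | (m, t, r) :: l' => vadd (lstate x0 l') (vscale t r)
  end.
Definition hstate {M n} (h : hist M n) : vec n := lstate (fst h) (snd h).

Definition sched_strat (M : Type) (n : nat) := hist M n -> (M * R)%type.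
Definition env_strat (M : Type) (n : nat) := hist M n -> M -> R -> vec n.

Definition sched_valid {M n} (s : sched_strat M n) : Prop :=
  forall h, 0 < snd (s h).
Definition env_valid {M n} (Rt : M -> vec n -> Prop) (e : env_strat M n) : Prop :=
  forall h m t, Rt m (e h m t).

Definition sched_positional {M n} (s : sched_strat M n) : Prop :=
  exists f : vec n -> (M * R)%type, forall h, s h = f (hstate h).
Definition env_positional {M n} (e : env_strat M n) : Prop :=
  exists g : vec n -> M -> R -> vec n, forall h m t, e h m t = g (hstate h) m t.

Fixpoint play {M n} (s : sched_strat M n) (e : env_strat M n) (x0 : vec n)
  (k : nat) : hist M n :=
  match k with
  | O => (x0, [])
  | S k' =>
      let h := play s e x0 k' in
      let mt := s h in
      (x0, (fst mt, snd mt, e h (fst mt) (snd mt)) :: snd h)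
  end.

(* data of round k+1: timed move and rate chosen from history after k rounds *)
Definition move_at {M n} s e (x0 : vec n) (k : nat) : (M * R)%type := s (play s e x0 k).
Definition rate_at {M n} (s : sched_strat M n) e x0 k : vec n :=
  e (play s e x0 k) (fst (move_at s e x0 k)) (snd (move_at s e x0 k)).
Definition state_at {M n} (s : sched_strat M n) e x0 k : vec n := hstate (play s e x0 k).

Definition run_safe {M n} (S : vec n -> Prop) (s : sched_strat M n) e x0 : Prop :=
  forall k t, 0 <= t <= snd (move_at s e x0 k) ->
    S (vadd (state_at s e x0 k) (vscale t (rate_at s e x0 k))).

Fixpoint total_time {M n} (s : sched_strat M n) e x0 (N : nat) : R :=
  match N with
  | O => 0
  | S N' => total_time s e x0 N' + snd (move_at s e x0 N')
  end.

Definition run_nonzeno {M n} (s : sched_strat M n) e x0 : Prop :=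
  forall B : R, exists N, B < total_time s e x0 N.

Definition sched_winning {M n} (Rt : M -> vec n -> Prop) (S : vec n -> Prop)
  (s : sched_strat M n) (x0 : vec n) : Prop :=
  sched_valid s /\
  forall e, env_valid Rt e -> run_safe S s e x0 /\ run_nonzeno s e x0.

Definition env_winning {M n} (Rt : M -> vec n -> Prop) (S : vec n -> Prop)
  (e : env_strat M n) (x0 : vec n) : Prop :=
  env_valid Rt e /\
  forall s, sched_valid s -> ~ (run_safe S s e x0 /\ run_nonzeno s e x0).

(* Main.v *)
(** Write [S] as a finite system of linear inequalities. The outcome is decided
    by whether the environment can fix, once and for all, a rate [r_m] for every
    mode so that, for some set [J] of constraints active at [x0] and some linear
    form [V], each [r_m] either violates a constraint of [J] at once or is
    tangent to all of [J] and increases [V]. If so, playing these constant rates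
    wins: [J] stays active and the bounded form [V] grows at least linearly with
    time. If not, then at every reachable state and for every linear form [V]
    some mode violates no active constraint and either deactivates one of them
    or does not increase [V]. The scheduler takes for [V] the gradient of the
    barrier [phi x = 1 + sum 1 / slack] over the inactive constraints, with a
    duration proportional to [phi^-2]. Constraints are never activated again, so
    the active set is eventually constant; from then on [phi^2] grows by at most
    2 per round and the durations dominate a harmonic series. *)

Require Import Defs.
From Stdlib Require Import Reals List Lra Lia Psatz.
From Stdlib Require Import Classical ClassicalEpsilon FunctionalExtensionality.
Import ListNotations.
Open Scope R_scope.

(** * Linear forms and their bounds on hulls *)

Definition linear {n} (f : vec n -> R) : Prop :=
  forall x y a, f (vadd x (vscale a y)) = f x + a * f y.

Lemma linear_zero {n} (f : vec n -> R) : linear f -> f vzero = 0.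
Proof.
  intros Hf. specialize (Hf vzero vzero 1).
  replace (vadd vzero (vscale 1 vzero)) with (@vzero n) in Hf; [lra|].
  extensionality i. unfold vadd, vscale, vzero. ring.
Qed.

Lemma linear_combine {n} (f : vec n -> R) x y a :
  linear f -> f (vadd (vscale a x) y) = a * f x + f y.
Proof.
  intros Hf. replace (vadd (vscale a x) y) with (vadd y (vscale a x)).
  - rewrite Hf. ring.
  - extensionality i. unfold vadd. ring.
Qed.

Lemma linear_lincomb {n} (f g : vec n -> R) a b :
  linear f -> linear g -> linear (fun x => a * f x + b * g x).
Proof. intros Hf Hg x y c. rewrite Hf, Hg. ring. Qed.

Lemma linear_const0 {n} : linear (fun _ : vec n => 0).
Proof. intros x y a. ring. Qed.

(** Monotonicity in the bound lets the maximum of the individual bounds serve for all. The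
    normalisation [1 <= B] makes the result usable as a positive factor. *)
Lemma finite_uniform_bound {A} (P : A -> R -> Prop) (l : list A) :
  (forall a B B', P a B -> B <= B' -> P a B') ->
  (forall a, In a l -> exists B, P a B) ->
  exists B, 1 <= B /\ forall a, In a l -> P a B.
Proof.
  intros Hmono. induction l as [|a l IH]; intros Hl.
  - exists 1. split; [lra|]. intros a [].
  - destruct (Hl a) as [B1 H1]; [now left|].
    destruct IH as [B2 [H2 H3]]; [intros; apply Hl; now right|].
    exists (Rmax B1 B2). split; [eapply Rle_trans; [exact H2|apply Rmax_r]|].
    intros a' [<-|Ha'].
    + eapply Hmono; [exact H1|apply Rmax_l].
    + eapply Hmono; [now apply H3|apply Rmax_r].
Qed.

Lemma linear_bounded_on_hull {n} (f : vec n -> R) (l : list (vec n)) :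
  linear f -> exists B, forall x, in_hull l x -> f x <= B.
Proof.
  intros Hf.
  destruct (finite_uniform_bound (fun v B => f v <= B) l) as [B [_ HB]].
  - intros; lra.
  - intros v _. exists (f v). lra.
  - exists B. intros x [c [Hc [Hs ->]]].
    (* Generalised to an arbitrary total weight, since the tail of a convex combination is no longer
       convex. *)
    enough (f (fold_right (fun p acc => vadd (vscale (fst p) (snd p)) acc) vzero c)
            <= B * fold_right Rplus 0 (map fst c)) as H by (rewrite Hs in H; lra).
    clear Hs. induction Hc as [|p c [Hp1 Hp2] Hc IH]; simpl.
    + rewrite linear_zero by assumption. lra.
    + rewrite linear_combine by assumption. specialize (HB _ Hp2). nra.
Qed.

(** * Polytopes as finite systems of inequalities *)

(* The pair [(f, b)] stands for the half-space [f x <= b]. *)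
Definition constr (n : nat) : Type := ((vec n -> R) * R)%type.

(** The homogenisation of [in_hull]: the total weight is a free coordinate [s], so that a generator
    can be split off. At [s = 1] it is [in_hull] by conversion. *)
Definition in_cone {n} (l : list (vec n)) (x : vec n) (s : R) : Prop :=
  exists c : list (R * vec n),
    Forall (fun p => 0 <= fst p /\ In (snd p) l) c /\
    fold_right Rplus 0 (map fst c) = s /\
    x = fold_right (fun p acc => vadd (vscale (fst p) (snd p)) acc) vzero c.

Lemma fin_enum (n : nat) : exists L : list (Fin.t n), forall i, In i L.
Proof.
  induction n as [|n [L HL]].
  - exists []. intros i. inversion i.
  - exists (Fin.F1 :: map Fin.FS L). intros i.
    pattern i. apply Fin.caseS'; [now left|].
    intros j. right. apply in_map, HL.
Qed.

(** A combination may list the new generator several times; [t] collects all the weight counted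
    against it. *)
Lemma in_cone_cons {n} (v : vec n) l x s :
  in_cone (v :: l) x s <->
  exists t, 0 <= t /\ in_cone l (vadd x (vscale (- t) v)) (s - t).
Proof.
  split.
  - intros [c [Hc [Hs Hx]]]. revert x s Hs Hx.
    induction Hc as [|p c [Hp1 Hp2] Hc IH]; simpl; intros x s Hs Hx.
    + exists 0. split; [lra|]. exists []. simpl. split; [constructor|].
      split; [lra|]. subst x. extensionality i. unfold vadd, vscale, vzero. ring.
    + destruct (IH _ _ eq_refl eq_refl) as [t [Ht [c' [Hc' [Hs' Hx']]]]].
      destruct Hp2 as [Hv|Hp2].
      * exists (t + fst p). split; [lra|]. exists c'. split; [assumption|].
        split; [lra|]. rewrite <- Hx', Hx, <- Hv.
        extensionality i. unfold vadd, vscale. ring.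
      * exists t. split; [assumption|]. exists (p :: c'). split; [now constructor|].
        simpl. split; [lra|]. rewrite <- Hx', Hx.
        extensionality i. unfold vadd, vscale. ring.
  - intros [t [Ht [c [Hc [Hs Hx]]]]]. exists ((t, v) :: c). split.
    + constructor; [simpl; auto|].
      eapply Forall_impl; [|exact Hc]. simpl. intuition.
    + simpl. split; [lra|]. rewrite <- Hx.
      extensionality i. unfold vadd, vscale. ring.
Qed.

(** The extra entry [0] accounts for the requirement [0 <= t] in the elimination and covers the
    empty list. *)
Lemma list_max_nonneg (l : list R) :
  exists t, In t (0 :: l) /\ forall y, In y (0 :: l) -> y <= t.
Proof.
  induction l as [|a l [t [Ht HM]]].
  - exists 0. split; [now left|]. intros y [<-|[]]. lra.
  - destruct (Rle_dec a t) as [Hat|Hat].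
    + exists t. split; [simpl in *; tauto|].
      intros y [<-|[<-|Hy]]; [apply HM; now left|assumption|apply HM; now right].
    + exists a. split; [simpl; tauto|].
      intros y [<-|[<-|Hy]]; [|lra|].
      * specialize (HM 0 (or_introl eq_refl)). lra.
      * specialize (HM y (or_intror Hy)). lra.
Qed.

(* One Fourier-Motzkin step: elimination of [t] from [0 <= t] and
   [L p <= t * al p]. *)
Lemma fourier_motzkin {A} (H : list A) (L al : A -> R) :
  (exists t, 0 <= t /\ forall p, In p H -> L p <= t * al p) <->
  (forall p, In p H -> al p <= 0 -> L p <= 0) /\
  (forall p q, In p H -> In q H -> 0 < al p -> al q < 0 ->
     al p * L q - al q * L p <= 0).
Proof.
  split.
  - intros [t [Ht HL]]. split.
    + intros p Hp Hal. specialize (HL p Hp). nra.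
    + intros p q Hp Hq H1 H2. pose proof (HL p Hp). pose proof (HL q Hq). nra.
  - intros [H0 H2].
    set (pos := fun p => if Rlt_dec 0 (al p) then true else false).
    (* The witness [t] is the largest of the lower bounds: [0] and all [L p / al p] with [al p]
       positive. *)
    destruct (list_max_nonneg (map (fun p => L p / al p) (filter pos H)))
      as [t [Ht Hmax]].
    exists t. split; [apply Hmax; now left|].
    intros p Hp.
    destruct (Rlt_dec 0 (al p)) as [Hal|Hal].
    + assert (L p / al p <= t) as Hle.
      { apply Hmax. right. apply (in_map (fun p => L p / al p)), filter_In.
        split; [assumption|]. unfold pos. now destruct (Rlt_dec 0 (al p)). }
      apply (Rmult_le_compat_r (al p)) in Hle; [|lra].
      unfold Rdiv in Hle. rewrite Rmult_assoc, Rinv_l in Hle; lra.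
    + destruct Ht as [<-|Ht].
      { specialize (H0 p Hp). lra. }
      destruct (Req_dec (al p) 0) as [E|E].
      { rewrite E, Rmult_0_r. apply H0; [assumption|lra]. }
      apply in_map_iff in Ht. destruct Ht as [q [<- Hq]].
      apply filter_In in Hq. destruct Hq as [Hq Hpos]. unfold pos in Hpos.
      destruct (Rlt_dec 0 (al q)) as [Hq0|]; [|discriminate].
      specialize (H2 q p Hq Hp Hq0 ltac:(lra)).
      apply (Rmult_le_reg_l (al q)); [assumption|].
      replace (al q * (L q / al q * al p)) with (L q * al p) by (field; lra).
      lra.
Qed.

(** Induction on the generators: adding [v] to the cone amounts to projecting out its weight [t],
    which a Fourier-Motzkin step does within finite systems. *)
Lemma cone_halfspaces {n} (l : list (vec n)) :
  exists H : list (constr n),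
    (forall p, In p H -> linear (fst p)) /\
    forall x s, in_cone l x s <-> forall p, In p H -> fst p x <= snd p * s.
Proof.
  induction l as [|v l [H [Hlin HH]]].
  - destruct (fin_enum n) as [L HL].
    (* The cone without generators is the origin with [s = 0]; each of these equations is written as
       two opposite inequalities. *)
    exists ((fun _ => 0, 1) :: (fun _ => 0, -1) ::
            map (fun i => (fun x : vec n => x i, 0)) L ++
            map (fun i => (fun x : vec n => - x i, 0)) L).
    split.
    + intros p [<-|[<-|Hp]]; try apply linear_const0.
      apply in_app_iff in Hp.
      destruct Hp as [Hp|Hp]; apply in_map_iff in Hp; destruct Hp as [i [<- _]];
        intros x y a; simpl; unfold vadd, vscale; ring.
    + intros x s. split.
      * intros [c [Hc [<- ->]]].
        destruct Hc as [|p c [_ []] _]; simpl.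
        intros p [<-|[<-|Hp]]; simpl; try lra.
        apply in_app_iff in Hp.
        destruct Hp as [Hp|Hp]; apply in_map_iff in Hp; destruct Hp as [i [<- _]];
          simpl; unfold vzero; lra.
      * intros Hx. exists []. simpl. split; [constructor|].
        pose proof (Hx _ (or_introl eq_refl)) as H1.
        pose proof (Hx _ (or_intror (or_introl eq_refl))) as H2.
        simpl in H1, H2. split; [lra|].
        extensionality i. unfold vzero.
        assert (x i <= 0 * s) as H3.
        { apply (Hx (fun x : vec n => x i, 0)). right; right.
          apply in_app_iff. left.
          apply (in_map (fun i => (fun x : vec n => x i, 0))), HL. }
        assert (- x i <= 0 * s) as H4.
        { apply (Hx (fun x : vec n => - x i, 0)). right; right.
          apply in_app_iff. right.
          apply (in_map (fun i => (fun x : vec n => - x i, 0))), HL. }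
        lra.
  (* Evaluated at [x - t v] with weight [s - t], the constraint [p] reads
     [fst p x - snd p * s <= t * al p]. *)
  - set (al := fun p : constr n => fst p v - snd p).
    (* The vacuous constraint [0 <= 0] fills the places where the sign conditions of the elimination
       fail. *)
    set (triv := (fun _ => 0, 0) : constr n).
    set (single := fun p => if Rle_dec (al p) 0 then p else triv).
    set (comb := fun pq : constr n * constr n =>
      let (p, q) := pq in
      if Rlt_dec 0 (al p) then if Rlt_dec (al q) 0 then
        (fun x => al p * fst q x + (- al q) * fst p x,
         al p * snd q - al q * snd p) : constr n
      else triv else triv).
    exists (map single H ++ map comb (list_prod H H)). split.
    + intros p Hp. apply in_app_iff in Hp.
      destruct Hp as [Hp|Hp]; apply in_map_iff in Hp.
      * destruct Hp as [q [<- Hq]]. unfold single.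
        destruct (Rle_dec _ _); [now apply Hlin|apply linear_const0].
      * destruct Hp as [[q1 q2] [<- Hq]]. apply in_prod_iff in Hq. unfold comb.
        destruct (Rlt_dec _ _); [|apply linear_const0].
        destruct (Rlt_dec _ _); [|apply linear_const0].
        apply linear_lincomb; apply Hlin; tauto.
    + intros x s. rewrite in_cone_cons.
      set (L := fun p : constr n => fst p x - snd p * s).
      assert ((exists t, 0 <= t /\ in_cone l (vadd x (vscale (- t) v)) (s - t)) <->
              (exists t, 0 <= t /\ forall p, In p H -> L p <= t * al p)) as E.
      { split; intros [t [Ht Hc]]; exists t; (split; [assumption|]).
        - intros p Hp. rewrite HH in Hc. specialize (Hc p Hp).
          rewrite Hlin in Hc by assumption. unfold L, al. lra.
        - apply HH. intros p Hp. specialize (Hc p Hp).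
          rewrite Hlin by assumption. unfold L, al in Hc. lra. }
      rewrite E, fourier_motzkin. split.
      * intros [H1 H2] p Hp. apply in_app_iff in Hp.
        destruct Hp as [Hp|Hp]; apply in_map_iff in Hp.
        -- destruct Hp as [q [<- Hq]]. unfold single.
           destruct (Rle_dec _ _) as [Ha|Ha]; [|simpl; lra].
           specialize (H1 q Hq Ha). unfold L in H1. lra.
        -- destruct Hp as [[q1 q2] [<- Hq]]. apply in_prod_iff in Hq. unfold comb.
           destruct (Rlt_dec _ _) as [Ha|Ha]; [|simpl; lra].
           destruct (Rlt_dec _ _) as [Hb|Hb]; [|simpl; lra].
           specialize (H2 q1 q2 (proj1 Hq) (proj2 Hq) Ha Hb).
           unfold L in H2. simpl. lra.
      * intros Hx. split.
        -- intros p Hp Ha. specialize (Hx (single p)). unfold single in Hx.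
           destruct (Rle_dec _ _) as [_|Hn]; [|contradiction].
           enough (fst p x <= snd p * s) by (unfold L; lra).
           apply Hx, in_app_iff. left. apply in_map_iff. exists p.
           split; [|assumption]. destruct (Rle_dec _ _); [reflexivity|contradiction].
        -- intros p q Hp Hq Ha Hb.
           specialize (Hx (comb (p, q))).
           assert (In (comb (p, q)) (map single H ++ map comb (list_prod H H))) as Hi
             by (apply in_app_iff; right; apply in_map, in_prod_iff; tauto).
           specialize (Hx Hi). unfold comb in Hx.
           destruct (Rlt_dec 0 (al p)); [|contradiction].
           destruct (Rlt_dec (al q) 0); [|contradiction].
           simpl in Hx. unfold L. lra.
Qed.

(** Weyl's half of the Minkowski-Weyl theorem, obtained by slicing the cone at weight [1]. *)
Lemma polytope_halfspaces {n} (S : vec n -> Prop) :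
  is_polytope S ->
  exists H : list (constr n),
    (forall p, In p H -> linear (fst p)) /\
    forall x, S x <-> forall p, In p H -> fst p x <= snd p.
Proof.
  intros [l Hl]. destruct (cone_halfspaces l) as [H [Hlin HH]].
  exists H. split; [assumption|]. intros x. rewrite Hl.
  change (in_hull l x) with (in_cone l x 1). rewrite HH.
  split; intros Hx p Hp; specialize (Hx p Hp); lra.
Qed.

(** * The environment *)

Lemma state_at_succ {M n} (s : sched_strat M n) e x0 k :
  state_at s e x0 (S k) =
  vadd (state_at s e x0 k) (vscale (snd (move_at s e x0 k)) (rate_at s e x0 k)).
Proof.
  assert (fst (play s e x0 k) = x0) as E by now destruct k.
  unfold state_at, rate_at, move_at, hstate. simpl. now rewrite E.
Qed.

(** [J] may be any set of active constraints, not necessarily all of them; this makes the property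
    persist when more constraints become active. *)
Definition trapped {M n} (H : list (constr n)) (Rt : M -> vec n -> Prop)
  (x : vec n) : Prop :=
  exists (J : constr n -> Prop) (r : M -> vec n) (V : vec n -> R),
    linear V /\ (forall m, Rt m (r m)) /\
    (forall p, J p -> In p H /\ fst p x = snd p) /\
    forall m, (exists p, J p /\ 0 < fst p (r m)) \/
              (0 < V (r m) /\ forall p, J p -> fst p (r m) = 0).

Lemma trapped_env_winning {M n} (Rt : M -> vec n -> Prop) (S : vec n -> Prop)
  (H : list (constr n)) (lm : list M) x0 :
  (forall m, In m lm) -> is_polytope S ->
  (forall p, In p H -> linear (fst p)) ->
  (forall x, S x -> forall p, In p H -> fst p x <= snd p) ->
  trapped H Rt x0 ->
  exists e, env_positional e /\ env_winning Rt S e x0.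
Proof.
  intros Hlm [l Hl] Hlin HS (J & r & V & HV & Hr & HJ & Hm).
  exists (fun _ m _ => r m). split; [now exists (fun _ m _ => r m)|].
  split; [intros h m t; apply Hr|].
  set (e := fun _ m _ => r m). intros s Hs [Hsafe Hnz].
  destruct (linear_bounded_on_hull V l HV) as [B HB].
  (* [c] dominates the reciprocals of all positive growth rates [V (r m)]. *)
  destruct (finite_uniform_bound (fun m c => 0 < V (r m) -> 1 <= c * V (r m)) lm)
    as [c [Hc1 Hc]].
  { intros m c c' Hc Hcc HVr. specialize (Hc HVr). nra. }
  { intros m _. exists (/ V (r m)). intros HVr. rewrite Rinv_l; lra. }
  assert (forall k, (forall p, J p -> fst p (state_at s e x0 k) = snd p) /\
    total_time s e x0 k <= c * (V (state_at s e x0 k) - V x0)) as Inv.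
  { induction k as [|k [IHJ IHT]].
    - split; [intros p Hp; now apply HJ|].
      change (state_at s e x0 0) with x0. simpl. lra.
    - rewrite state_at_succ. set (x := state_at s e x0 k) in *.
      assert (0 < snd (move_at s e x0 k)) as Ht by apply Hs.
      pose proof (Hsafe k (snd (move_at s e x0 k)) ltac:(lra)) as Hk.
      fold x in Hk. simpl total_time.
      set (t := snd (move_at s e x0 k)) in *.
      change (rate_at s e x0 k) with (r (fst (move_at s e x0 k))) in *.
      set (m := fst (move_at s e x0 k)) in *.
      destruct (Hm m) as [[p [Hp Hpos]]|[HVr Htan]].
      (* Any positive time spent in such a mode crosses a constraint of [J] that was active, against
         safety. *)
      + exfalso. destruct (HJ p Hp) as [HpH _].
        specialize (HS _ Hk p HpH). rewrite Hlin, IHJ in HS by assumption. nra.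
      + split.
        * intros p Hp. rewrite Hlin by now apply HJ.
          rewrite IHJ, Htan by assumption. ring.
        * rewrite HV. specialize (Hc m (Hlm m) HVr). nra. }
  (* Beyond this time the invariant would force [V] above its maximum [B] over [S]. *)
  destruct (Hnz (c * (B - V x0))) as [N HN].
  destruct (Inv N) as [_ HT].
  assert (V (state_at s e x0 N) <= B) as HVB.
  { assert (0 < snd (move_at s e x0 N)) as Ht by apply Hs.
    pose proof (Hsafe N 0 ltac:(lra)) as H0. apply Hl, HB in H0.
    rewrite HV in H0. lra. }
  nra.
Qed.

(** * The scheduler *)

Definition slack {n} (p : constr n) (x : vec n) : R := snd p - fst p x.

Definition rsum {A} (F : A -> R) (l : list A) : R :=
  fold_right (fun a s => F a + s) 0 l.

(* Active constraints contribute nothing to either sum, because [/ 0 = 0]. *)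
Definition barrier {n} (H : list (constr n)) (x : vec n) : R :=
  1 + rsum (fun p => / slack p x) H.
Definition barrier_grad {n} (H : list (constr n)) (x r : vec n) : R :=
  rsum (fun p => (/ slack p x) ^ 2 * fst p r) H.

Lemma rsum_le {A} (F G : A -> R) l :
  (forall a, In a l -> F a <= G a) -> rsum F l <= rsum G l.
Proof.
  induction l as [|a l IH]; simpl; intros HFG; [lra|].
  specialize (IH (fun b Hb => HFG b (or_intror Hb))).
  specialize (HFG a (or_introl eq_refl)). lra.
Qed.

Lemma rsum_comb3 {A} (F G K : A -> R) a b l :
  rsum (fun p => F p + a * G p + b * K p) l =
  rsum F l + a * rsum G l + b * rsum K l.
Proof. induction l as [|p l IH]; simpl; [ring|rewrite IH; ring]. Qed.

Lemma rsum_nonneg {A} (F : A -> R) l :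
  (forall a, In a l -> 0 <= F a) -> 0 <= rsum F l.
Proof.
  induction l as [|a l IH]; simpl; intros HF; [lra|].
  specialize (IH (fun b Hb => HF b (or_intror Hb))).
  specialize (HF a (or_introl eq_refl)). lra.
Qed.

Lemma rsum_ge_term {A} (F : A -> R) l a :
  (forall b, In b l -> 0 <= F b) -> In a l -> F a <= rsum F l.
Proof.
  induction l as [|b l IH]; simpl; intros HF; [intros []|].
  pose proof (rsum_nonneg F l (fun c Hc => HF c (or_intror Hc))).
  pose proof (HF b (or_introl eq_refl)).
  intros [<-|Ha]; [lra|].
  specialize (IH (fun c Hc => HF c (or_intror Hc)) Ha). lra.
Qed.

Lemma barrier_grad_linear {n} (H : list (constr n)) x :
  (forall p, In p H -> linear (fst p)) -> linear (barrier_grad H x).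
Proof.
  intros Hlin y z a.
  induction H as [|p H IH]; [unfold barrier_grad; simpl; ring|].
  assert (forall v, barrier_grad (p :: H) x v =
                    (/ slack p x) ^ 2 * fst p v + barrier_grad H x v) as E
    by reflexivity.
  rewrite !E, IH by (intros; apply Hlin; now right).
  rewrite (Hlin p) by now left. ring.
Qed.

Lemma Rinv_nonneg (x : R) : 0 <= x -> 0 <= / x.
Proof.
  intros [Hx|<-]; [left; now apply Rinv_0_lt_compat|rewrite Rinv_0; lra].
Qed.

(** Taylor expansion with explicit remainder, for [d] of either sign. Multiplied by [s - d], the
    right side becomes [1 + (d / s) ^ 2 * (1 - 2 * d / s)], which is at least [1]. *)
Lemma Rinv_second_order (s d : R) :
  0 < s -> d <= s / 2 ->
  / (s - d) <= / s + d * (/ s) ^ 2 + 2 * d ^ 2 * (/ s) ^ 3.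
Proof.
  intros Hs Hd. apply (Rmult_le_reg_l (s - d)); [lra|].
  rewrite Rinv_r by lra.
  replace ((s - d) * (/ s + d * (/ s) ^ 2 + 2 * d ^ 2 * (/ s) ^ 3))
    with (1 + (d * / s) ^ 2 * (/ s * (s - 2 * d))) by (field; lra).
  pose proof (Rinv_0_lt_compat s Hs) as Hi.
  pose proof (pow2_ge_0 (d * / s)).
  assert (0 <= / s * (s - 2 * d)) by (apply Rmult_le_pos; lra).
  nra.
Qed.

(** * Estimates for one move of the scheduler *)

Section BarrierStep.
Context {n : nat} (H : list (constr n)) (C : R) (x r : vec n).
Hypothesis Hlin : forall p, In p H -> linear (fst p).
Hypothesis HC : 1 <= C.
Hypothesis Hslack : forall p, In p H -> 0 <= slack p x.
Hypothesis Hrate : forall p, In p H -> Rabs (fst p r) <= C.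
Hypothesis Hact : forall p, In p H -> slack p x = 0 -> fst p r <= 0.

Let phi := barrier H x.
Let t := / (2 * C * phi ^ 2).

Lemma slack_move p a : In p H ->
  slack p (vadd x (vscale a r)) = slack p x - a * fst p r.
Proof. intros Hp. unfold slack. rewrite Hlin by assumption. ring. Qed.

Lemma barrier_ge1 : 1 <= phi.
Proof.
  unfold phi, barrier.
  enough (0 <= rsum (fun p => / slack p x) H) by lra.
  apply rsum_nonneg. intros p Hp. now apply Rinv_nonneg, Hslack.
Qed.

Lemma inv_slack_le_barrier p : In p H -> / slack p x <= phi.
Proof.
  intros Hp. unfold phi, barrier.
  enough (/ slack p x <= rsum (fun p => / slack p x) H) by lra.
  apply (rsum_ge_term (fun p => / slack p x)); [|assumption].
  intros q Hq. now apply Rinv_nonneg, Hslack.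
Qed.

Lemma step_size : 0 < t /\ t * C * phi ^ 2 = / 2.
Proof.
  pose proof barrier_ge1. assert (0 < phi ^ 2) by nra. unfold t. split.
  - apply Rinv_0_lt_compat. nra.
  - field. nra.
Qed.

(** Since [phi] is at least [1] and at least every reciprocal slack, [t * C = / (2 * phi ^ 2)] is at
    most half of any nonzero slack. *)
Lemma step_le_half_slack p a : In p H -> slack p x <> 0 -> 0 <= a <= t ->
  Rabs (a * fst p r) <= slack p x / 2.
Proof.
  intros Hp Hne Ha.
  pose proof (Hslack p Hp). assert (0 < slack p x) as Hs by lra.
  pose proof (inv_slack_le_barrier p Hp) as Hle.
  pose proof barrier_ge1. destruct step_size as [Ht HtC].
  rewrite Rabs_mult, (Rabs_pos_eq a) by lra.
  pose proof (Hrate p Hp). pose proof (Rabs_pos (fst p r)).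
  assert (a * Rabs (fst p r) <= t * C) by (apply Rmult_le_compat; lra).
  assert (1 <= phi * slack p x).
  { apply (Rmult_le_compat_r (slack p x)) in Hle; [|lra].
    rewrite Rinv_l in Hle; lra. }
  assert (0 <= t * C) by nra.
  assert (t * C * phi <= / 2) by nra.
  assert (t * C * 1 <= t * C * (phi * slack p x))
    by (apply Rmult_le_compat_l; lra).
  nra.
Qed.

(** An inactive constraint keeps at least half of its slack, and [Hact] protects an active one.
    Hence no constraint becomes newly active. *)
Lemma step_safe p a : In p H -> 0 <= a <= t ->
  0 <= slack p (vadd x (vscale a r)) /\
  (slack p (vadd x (vscale a r)) = 0 -> slack p x = 0).
Proof.
  intros Hp Ha. rewrite slack_move by assumption.
  pose proof (Hslack p Hp).
  destruct (Req_dec (slack p x) 0) as [E|E].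
  - pose proof (Hact p Hp E). split; [nra|tauto].
  - pose proof (step_le_half_slack p a Hp E Ha) as Hh.
    pose proof (Rle_abs (a * fst p r)). split; lra.
Qed.

(** The first-order term is [t * barrier_grad H x r], hence nonpositive, and the remainders add up
    to at most [t * C * phi]. Squaring [phi * (1 + t * C)] and using [t * C * phi ^ 2 = / 2] gives
    [phi ^ 2 + 1 + t * C / 2]. *)
Lemma barrier_step :
  barrier_grad H x r <= 0 ->
  (forall p, In p H -> slack p x = 0 -> fst p r = 0) ->
  barrier H (vadd x (vscale t r)) ^ 2 <= phi ^ 2 + 2.
Proof.
  intros Hgrad Htan.
  pose proof barrier_ge1 as Hphi. destruct step_size as [Ht HtC].
  set (y := vadd x (vscale t r)).
  (* In the cubic remainder two factors [/ slack p x] are bounded by [phi]; the third is kept so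
     that the sum over [p] gives back [phi - 1]. *)
  assert (rsum (fun p => / slack p y) H <=
          rsum (fun p => / slack p x + t * ((/ slack p x) ^ 2 * fst p r)
                         + (2 * (t * C) ^ 2 * phi ^ 2) * / slack p x) H) as Hsum.
  { apply rsum_le. intros p Hp. unfold y. rewrite slack_move by assumption.
    destruct (Req_dec (slack p x) 0) as [E|E].
    (* A tangent move keeps an active constraint active, so both sides vanish through [/ 0 = 0]. *)
    - rewrite (Htan p Hp E), E, Rmult_0_r, Rminus_0_r, Rinv_0. lra.
    - pose proof (step_le_half_slack p t Hp E ltac:(lra)) as Hh.
      pose proof (Hslack p Hp).
      pose proof (Rle_abs (t * fst p r)).
      pose proof (Rinv_second_order (slack p x) (t * fst p r)
                    ltac:(lra) ltac:(lra)) as Ho.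
      pose proof (inv_slack_le_barrier p Hp) as Hle.
      assert (0 <= / slack p x) as Hi by (apply Rinv_nonneg; lra).
      set (w := / slack p x) in *.
      assert ((t * fst p r) ^ 2 <= (t * C) ^ 2).
      { apply pow_maj_Rabs. rewrite Rabs_mult, Rabs_pos_eq by lra.
        apply Rmult_le_compat_l; [lra|now apply Hrate]. }
      assert (w ^ 2 <= phi ^ 2) by nra.
      assert ((t * fst p r) ^ 2 * w ^ 2 <= (t * C) ^ 2 * phi ^ 2)
        by (apply Rmult_le_compat; nra).
      assert ((t * fst p r) ^ 2 * w ^ 2 * w <= (t * C) ^ 2 * phi ^ 2 * w)
        by (apply Rmult_le_compat_r; lra).
      lra. }
  rewrite rsum_comb3 in Hsum. fold (barrier_grad H x r) in Hsum.
  assert (rsum (fun p => / slack p x) H = phi - 1) as E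
    by (unfold phi, barrier; ring).
  rewrite E in Hsum.
  assert (0 <= rsum (fun p => / slack p y) H) as H0.
  { apply rsum_nonneg. intros p Hp. apply Rinv_nonneg. unfold y.
    apply (step_safe p t Hp). lra. }
  unfold barrier. set (psi := rsum (fun p => / slack p y) H) in *.
  assert (2 * (t * C) ^ 2 * phi ^ 2 = t * C) as E2.
  { replace (2 * (t * C) ^ 2 * phi ^ 2)
      with (2 * (t * C) * (t * C * phi ^ 2)) by ring.
    rewrite HtC. field. }
  rewrite E2 in Hsum.
  assert (0 < t * C) by nra.
  assert (t * barrier_grad H x r <= 0) by nra.
  assert (1 + psi <= phi + t * C * phi) as Hpsi by nra.
  assert ((1 + psi) ^ 2 <= (phi + t * C * phi) ^ 2) by (apply pow_incr; lra).
  assert (t * C <= / 2) by nra.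
  nra.
Qed.

End BarrierStep.

(** * Stabilisation of the active set and divergence of the elapsed time *)

Lemma filter_length_le {A} (f g : A -> bool) l :
  (forall a, In a l -> f a = true -> g a = true) ->
  (length (filter f l) <= length (filter g l))%nat.
Proof.
  induction l as [|a l IH]; simpl; intros Hfg; [lia|].
  specialize (IH (fun b Hb => Hfg b (or_intror Hb))).
  specialize (Hfg a (or_introl eq_refl)).
  destruct (f a), (g a); simpl; intuition (discriminate || lia).
Qed.

Lemma filter_length_lt {A} (f g : A -> bool) l a :
  (forall a, In a l -> f a = true -> g a = true) ->
  In a l -> f a = false -> g a = true ->
  (length (filter f l) < length (filter g l))%nat.
Proof.
  intros Hfg Ha Hf Hg.
  destruct (in_split _ _ Ha) as [l1 [l2 ->]].
  rewrite !filter_app, !length_app. simpl. rewrite Hf, Hg. simpl.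
  pose proof (filter_length_le f g l1) as H1.
  pose proof (filter_length_le f g l2) as H2.
  assert (length (filter f l1) <= length (filter g l1))%nat
    by (apply H1; intros; apply Hfg; [apply in_app_iff; auto|assumption]).
  assert (length (filter f l2) <= length (filter g l2))%nat
    by (apply H2; intros; apply Hfg; [apply in_app_iff; simpl; auto|assumption]).
  lia.
Qed.

(** Induction on an upper bound: either the sequence drops strictly below it at some later index, or
    it equals the bound from [k] on. *)
Lemma nonincreasing_eventually_constant (u : nat -> nat) :
  (forall k, u (S k) <= u k)%nat ->
  exists K, forall j, u (K + S j)%nat = u (K + j)%nat.
Proof.
  intros Hu.
  enough (forall N k, (u k <= N)%nat ->
            exists K, forall j, u (K + S j)%nat = u (K + j)%nat) as HN
    by exact (HN _ 0%nat (le_n _)).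
  induction N as [|N IH]; intros k Hk.
  - exists k. intros j.
    assert (forall i, u (k + i)%nat = 0%nat) as E.
    { induction i as [|i IHi]; [rewrite Nat.add_0_r; lia|].
      rewrite Nat.add_succ_r. specialize (Hu (k + i)%nat). lia. }
    now rewrite !E.
  - destruct (classic (exists j, (u (k + j) <= N)%nat)) as [[j Hj]|Hno];
      [exact (IH _ Hj)|].
    exists k. intros j.
    assert (forall i, u (k + i)%nat = S N) as E.
    { induction i as [|i IHi].
      - rewrite Nat.add_0_r. apply Nat.le_antisymm; [assumption|].
        apply Nat.nle_gt. intros Hle. apply Hno. exists 0%nat.
        now rewrite Nat.add_0_r.
      - specialize (Hu (k + i)%nat). rewrite <- Nat.add_succ_r in Hu.
        apply Nat.le_antisymm; [lia|].
        apply Nat.nle_gt. intros Hle. apply Hno. now exists (S i). }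
    now rewrite !E.
Qed.

(** Comparison with a logarithm: [ln (D + 2) - ln D <= 2 / D], so the increments of [T] dominate
    those of [c / 2 * ln (A + 2 * INR j)]. *)
Lemma harmonic_divergence (T : nat -> R) (A c : R) :
  0 < A -> 0 < c ->
  (forall j, T j + c / (A + 2 * INR j) <= T (S j)) ->
  forall B, exists j, B < T j.
Proof.
  intros HA Hc HT B.
  assert (forall j, T 0%nat + c / 2 * (ln (A + 2 * INR j) - ln A) <= T j) as Hln.
  { induction j as [|j IH]; [simpl; rewrite Rmult_0_r, Rplus_0_r; lra|].
    specialize (HT j). pose proof (pos_INR j). rewrite S_INR.
    set (D := A + 2 * INR j) in *. assert (0 < D) by (unfold D; lra).
    replace (A + 2 * (INR j + 1)) with (D * (1 + 2 / D)) by (unfold D; field; lra).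
    assert (0 < 2 / D) as Hd by (apply Rdiv_lt_0_compat; lra).
    rewrite ln_mult by lra.
    pose proof (exp_ineq1 (2 / D) ltac:(lra)) as He.
    assert (ln (1 + 2 / D) <= 2 / D) as Hl.
    { rewrite <- (ln_exp (2 / D)) at 2. left. apply ln_increasing; lra. }
    apply (Rmult_le_compat_l (c / 2)) in Hl; [|lra].
    replace (c / 2 * (2 / D)) with (c / D) in Hl by (field; lra).
    lra. }
  (* [E] is the argument at which the logarithmic lower bound reaches [B]. *)
  set (E := exp (2 / c * (B - T 0%nat) + ln A)).
  destruct (INR_unbounded E) as [j Hj]. exists j.
  specialize (Hln j). pose proof (pos_INR j).
  assert (E < A + 2 * INR j) as HE by lra.
  apply ln_increasing in HE; [|apply exp_pos].
  unfold E in HE. rewrite ln_exp in HE.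
  assert (c / 2 * (2 / c * (B - T 0%nat)) < c / 2 * (ln (A + 2 * INR j) - ln A))
    as Hm by (apply Rmult_lt_compat_l; lra).
  replace (c / 2 * (2 / c * (B - T 0%nat))) with (B - T 0%nat) in Hm
    by (field; lra).
  lra.
Qed.

(** * Untrapped states and the strategy of the scheduler *)

(** By contraposition: if every mode had a bad rate, choosing one for each mode, with [J] the full
    active set and the given [V], would form a trap. *)
Lemma untrapped_mode {M n} (H : list (constr n)) (Rt : M -> vec n -> Prop) x V :
  linear V -> ~ trapped H Rt x ->
  exists m, forall r, Rt m r ->
    (forall p, In p H -> slack p x = 0 -> fst p r <= 0) /\
    (V r <= 0 \/ exists p, In p H /\ slack p x = 0 /\ fst p r < 0).
Proof.
  intros HV Hnt. apply NNPP. intros Hno. apply Hnt.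
  set (J := fun p => In p H /\ slack p x = 0).
  assert (forall m, exists r, Rt m r /\
    ((exists p, J p /\ 0 < fst p r) \/ (0 < V r /\ forall p, J p -> fst p r = 0)))
    as Hex.
  { intros m. apply NNPP. intros Hm. apply Hno. exists m. intros r Hr.
    assert (forall p, In p H -> slack p x = 0 -> fst p r <= 0) as Hle.
    { intros p Hp Hs. apply Rnot_lt_le. intros Hlt. apply Hm.
      exists r. split; [assumption|]. left. now exists p. }
    split; [assumption|].
    apply NNPP. intros Hn. apply Hm. exists r. split; [assumption|]. right.
    split; [apply Rnot_le_lt; tauto|].
    intros p [Hp Hs]. apply Rle_antisym; [now apply Hle|].
    apply Rnot_lt_le. intros Hlt. apply Hn. right. now exists p. }
  exists J, (fun m => proj1_sig (constructive_indefinite_description _ (Hex m))), V.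
  repeat split; try assumption.
  - intros m. now destruct (constructive_indefinite_description _ (Hex m)).
  - now destruct H0.
  - destruct H0 as [_ E]. unfold slack in E. lra.
  - intros m. destruct (constructive_indefinite_description _ (Hex m)) as [r [Hr Hd]].
    exact Hd.
Qed.

(** The same [J], [r] and [V] serve at [x]. Contraposed, a move that activates nothing new leads
    from untrapped states to untrapped states. *)
Lemma trapped_anti {M n} (H : list (constr n)) (Rt : M -> vec n -> Prop) x y :
  (forall p, In p H -> slack p y = 0 -> slack p x = 0) ->
  trapped H Rt y -> trapped H Rt x.
Proof.
  intros Hsub (J & r & V & HV & Hr & HJ & Hm).
  exists J, r, V. repeat split; try assumption.
  - now apply HJ.
  - destruct (HJ p H0) as [Hp E]. specialize (Hsub p Hp).
    unfold slack in Hsub. lra.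
Qed.

Lemma rates_bounded {M n} (H : list (constr n)) (Rt : M -> vec n -> Prop) (lm : list M) :
  (forall m, In m lm) -> (forall m, is_polytope (Rt m)) ->
  (forall p, In p H -> linear (fst p)) ->
  exists C, 1 <= C /\ forall p, In p H -> forall m r, Rt m r -> Rabs (fst p r) <= C.
Proof.
  intros Hlm HP Hlin.
  apply (finite_uniform_bound
    (fun (p : constr n) C => forall m r, Rt m r -> Rabs (fst p r) <= C)).
  - intros p B B' HB HBB m r Hr. specialize (HB m r Hr). lra.
  - intros p Hp.
    destruct (finite_uniform_bound
      (fun m C => forall r, Rt m r -> Rabs (fst p r) <= C) lm) as [B [_ HB]].
    + intros m B B' HB HBB r Hr. specialize (HB r Hr). lra.
    + intros m _. destruct (HP m) as [l Hl].
      pose proof (Hlin p Hp) as Hf.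
      destruct (linear_bounded_on_hull (fst p) l Hf) as [B1 H1].
      (* The bound from below is a bound from above for the opposite form. *)
      destruct (linear_bounded_on_hull (fun x => (-1) * fst p x + 0 * fst p x) l)
        as [B2 H2]; [now apply linear_lincomb|].
      exists (Rmax B1 B2). intros r Hr. apply Hl in Hr.
      specialize (H1 r Hr). specialize (H2 r Hr).
      pose proof (Rmax_l B1 B2). pose proof (Rmax_r B1 B2).
      apply Rabs_le. lra.
    + exists B. intros m. apply HB, Hlm.
Qed.

Lemma untrapped_sched_winning {M n} (Rt : M -> vec n -> Prop) (S : vec n -> Prop)
  (H : list (constr n)) (lm : list M) x0 :
  inhabited M -> (forall m, In m lm) -> (forall m, is_polytope (Rt m)) ->
  (forall p, In p H -> linear (fst p)) ->
  (forall x, S x <-> forall p, In p H -> fst p x <= snd p) ->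
  S x0 -> ~ trapped H Rt x0 ->
  exists s, sched_positional s /\ sched_winning Rt S s x0.
Proof.
  intros [m0] Hlm HP Hlin HS Hx0 Hnt.
  destruct (rates_bounded H Rt lm Hlm HP Hlin) as [C [HC Hrate]].
  assert (forall x, exists m, ~ trapped H Rt x -> forall r, Rt m r ->
    (forall p, In p H -> slack p x = 0 -> fst p r <= 0) /\
    (barrier_grad H x r <= 0 \/
     exists p, In p H /\ slack p x = 0 /\ fst p r < 0)) as Hex.
  { intros x. destruct (classic (trapped H Rt x)) as [Ht|Ht].
    (* A positional strategy needs a mode at every point; at trapped ones any mode will do. *)
    - exists m0. tauto.
    - destruct (untrapped_mode H Rt x (barrier_grad H x)
                  (barrier_grad_linear H x Hlin) Ht) as [m Hm].
      now exists m. }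
  set (mode := fun x => proj1_sig (constructive_indefinite_description _ (Hex x))).
  assert (forall x, ~ trapped H Rt x -> forall r, Rt (mode x) r ->
    (forall p, In p H -> slack p x = 0 -> fst p r <= 0) /\
    (barrier_grad H x r <= 0 \/
     exists p, In p H /\ slack p x = 0 /\ fst p r < 0)) as Hmode
    by (intros x; apply (proj2_sig (constructive_indefinite_description _ (Hex x)))).
  clearbody mode. clear Hex.
  (* Outside [S] the barrier may vanish, so the duration needs a default there. *)
  set (dur := fun x => if Rlt_dec 0 (barrier H x)
                       then / (2 * C * barrier H x ^ 2) else 1).
  set (f := fun x => (mode x, dur x)).
  set (s := (fun h => f (hstate h)) : sched_strat M n).
  assert (forall x, (forall p, In p H -> 0 <= slack p x) ->
            dur x = / (2 * C * barrier H x ^ 2)) as Hdur.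
  { intros x Hx. unfold dur. pose proof (barrier_ge1 H x Hx).
    destruct (Rlt_dec _ _); [reflexivity|lra]. }
  exists s. split; [now exists f|]. split.
  { intros h. unfold s, f, dur. simpl.
    destruct (Rlt_dec _ _); [|lra]. apply Rinv_0_lt_compat. nra. }
  intros e He.
  set (x := state_at s e x0).
  set (r := rate_at s e x0).
  assert (forall k, Rt (mode (x k)) (r k)) as Hr by (intros k; apply He).
  assert (forall k, x (Datatypes.S k) = vadd (x k) (vscale (dur (x k)) (r k))) as Hx
    by (intros k; exact (state_at_succ s e x0 k)).
  set (inv := fun y => ~ trapped H Rt y /\ forall p, In p H -> 0 <= slack p y).
  assert (forall y, inv y -> 0 < dur y) as Hdpos.
  { intros y [_ Hy]. rewrite Hdur by assumption. now apply step_size. }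
  (* Stated for all intermediate times [a]: this gives safety during the move and, at
     [a = dur (x k)], the next instance of the invariant. *)
  assert (forall k, inv (x k) -> forall p a, In p H -> 0 <= a <= dur (x k) ->
    0 <= slack p (vadd (x k) (vscale a (r k))) /\
    (slack p (vadd (x k) (vscale a (r k))) = 0 -> slack p (x k) = 0)) as Hstep.
  { intros k [Ht Hs] p a Hp Ha.
    destruct (Hmode _ Ht _ (Hr k)) as [Hact _]. rewrite Hdur in Ha by assumption.
    apply step_safe with (H := H) (C := C); try assumption.
    intros q Hq. now apply (Hrate q Hq (mode (x k))). }
  assert (forall k, inv (x k)) as Inv.
  { induction k as [|k IH].
    - split; [exact Hnt|]. intros p Hp. change (x 0%nat) with x0.
      unfold slack. specialize (proj1 (HS x0) Hx0 p Hp). lra.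
    - pose proof (Hdpos _ IH) as Hd.
      pose proof (fun p Hp => Hstep k IH p (dur (x k)) Hp ltac:(lra)) as Hk.
      rewrite <- Hx in Hk. split; [|intros p Hp; now apply Hk].
      intros Htr. apply (proj1 IH). revert Htr. apply trapped_anti.
      intros p Hp. now apply Hk. }
  assert (forall k, 0 < dur (x k)) as Hpos by (intros k; apply Hdpos, Inv).
  split.
  { intros k a Ha. apply HS. intros p Hp.
    destruct (Hstep k (Inv k) p a Hp Ha) as [H0 _]. unfold slack in H0.
    change (fst p (vadd (x k) (vscale a (r k))) <= snd p). lra. }
  set (act := fun y (p : constr n) => if Req_dec_T (slack p y) 0 then true else false).
  assert (forall y p, act y p = true <-> slack p y = 0) as Hacts.
  { intros y p. unfold act. destruct (Req_dec_T _ _); intuition discriminate. }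
  assert (forall k p, In p H -> act (x (Datatypes.S k)) p = true -> act (x k) p = true)
    as Hmon.
  { intros k p Hp. rewrite !Hacts, Hx. apply Hstep; [apply Inv|assumption|].
    specialize (Hpos k). lra. }
  (* From round [K] on the number of active constraints, and so by [Hmon] the active set itself, no
     longer changes. *)
  destruct (nonincreasing_eventually_constant
              (fun k => length (filter (act (x k)) H))) as [K HK].
  { intros k. apply filter_length_le. intros p Hp. now apply Hmon. }
  assert (forall j, barrier H (x (K + j)%nat) ^ 2 <=
                    barrier H (x K) ^ 2 + 2 * INR j) as Hgrow.
  { induction j as [|j IH]; [rewrite Nat.add_0_r; simpl; lra|].
    rewrite S_INR. set (k := (K + j)%nat) in *.
    replace (K + Datatypes.S j)%nat with (Datatypes.S k) by (unfold k; lia).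
    destruct (Inv k) as [IHt IHs].
    destruct (Hmode _ IHt _ (Hr k)) as [Hle Hor].
    (* A negative rate would deactivate [p] and lower the stabilised count. This leaves only the
       gradient alternative of [Hor]. *)
    assert (forall p, In p H -> slack p (x k) = 0 -> fst p (r k) = 0) as Htan.
    { intros p Hp Hs0. apply Rle_antisym; [now apply Hle|].
      apply Rnot_lt_le. intros Hlt.
      specialize (HK j). fold k in HK.
      replace (K + Datatypes.S j)%nat with (Datatypes.S k) in HK by (unfold k; lia).
      enough (length (filter (act (x (Datatypes.S k))) H)
              < length (filter (act (x k)) H))%nat by lia.
      apply filter_length_lt with p; try assumption.
      - intros q Hq. now apply Hmon.
      - apply Bool.not_true_is_false. rewrite Hacts, Hx.
        rewrite (slack_move H) by assumption. specialize (Hpos k). nra.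
      - now apply Hacts. }
    destruct Hor as [Hg|[p [Hp [Hs0 Hlt]]]];
      [|specialize (Htan p Hp Hs0); lra].
    rewrite Hx, Hdur by assumption.
    pose proof (barrier_step H C (x k) (r k) Hlin HC IHs
      (fun q Hq => Hrate q Hq _ _ (Hr k)) Hle Hg Htan). lra. }
  pose proof (barrier_ge1 H (x K) (proj2 (Inv K))) as HK1.
  intros B.
  destruct (harmonic_divergence (fun j => total_time s e x0 (K + j))
              (barrier H (x K) ^ 2) (/ (2 * C))) with (B := B) as [j Hj].
  - nra.
  - apply Rinv_0_lt_compat. lra.
  (* The duration [/ (2 * C * phi ^ 2)] is bounded below by means of [Hgrow], with time counted from
     round [K]. *)
  - intros j. rewrite Nat.add_succ_r.
    change (total_time s e x0 (Datatypes.S (K + j)))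
      with (total_time s e x0 (K + j) + dur (x (K + j)%nat)).
    rewrite (Hdur (x (K + j)%nat)) by apply Inv.
    pose proof (barrier_ge1 H (x (K + j)%nat) (proj2 (Inv (K + j)%nat))).
    specialize (Hgrow j). pose proof (pos_INR j).
    apply Rplus_le_compat_l. rewrite (Rinv_mult (2 * C)). unfold Rdiv.
    apply Rmult_le_compat_l; [left; apply Rinv_0_lt_compat; lra|].
    apply Rinv_le_contravar; [apply pow_lt; lra|assumption].
  - now exists (K + j)%nat.
Qed.

(** * Positional determinacy *)

Theorem theorem1 (M : Type) (n : nat) (Rt : M -> vec n -> Prop) (S : vec n -> Prop)
  (HB : is_BMS M n Rt) (HS : is_polytope S) (x0 : vec n) (Hx0 : S x0) :
  ((exists s, sched_winning Rt S s x0) \/ (exists e, env_winning Rt S e x0)) /\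
  ~ ((exists s, sched_winning Rt S s x0) /\ (exists e, env_winning Rt S e x0)) /\
  ((exists s, sched_winning Rt S s x0) ->
     exists s, sched_positional s /\ sched_winning Rt S s x0) /\
  ((exists e, env_winning Rt S e x0) ->
     exists e, env_positional e /\ env_winning Rt S e x0).
Proof.
  destruct HB as [[lm Hlm] [HM [_ HR]]].
  destruct (polytope_halfspaces S HS) as [H [Hlin HH]].
  assert (~ ((exists s, sched_winning Rt S s x0) /\
             (exists e, env_winning Rt S e x0))) as Hexcl.
  (* Playing the two winning strategies against each other gives a contradiction. *)
  { intros [[s [Hs Hsw]] [e [He Hew]]]. exact (Hew s Hs (Hsw e He)). }
  (* Either case yields a positional winner; the positional claim for the other player then holds
     vacuously by [Hexcl]. *)
  destruct (classic (trapped H Rt x0)) as [Ht|Ht].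
  - assert (exists e, env_positional e /\ env_winning Rt S e x0) as [e [Hp He]].
    { apply (trapped_env_winning Rt S H lm); try assumption. apply HH. }
    split; [right; now exists e|]. split; [assumption|]. split; [|now exists e].
    intros Hs. exfalso. apply Hexcl. split; [assumption|now exists e].
  - assert (exists s, sched_positional s /\ sched_winning Rt S s x0) as [s [Hp Hs]].
    { apply (untrapped_sched_winning Rt S H lm); try assumption.
      intros m. apply HR. }
    split; [left; now exists s|]. split; [assumption|]. split; [now exists s|].
    intros He. exfalso. apply Hexcl. split; [now exists s|assumption].
Qed.
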